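(* Let $\mathcal{A}=\{A_1,\ldots,A_m\}$ be a finite set of matrices in $\mathbb{R}^{n\times n}$. Let $\tilde G(\{1\},E)$ be a path-complete graph with a single node, and let $l$ be the length of the shortest word in $\tilde{\mathcal{A}}=\{L(e): e\in E\}$, where $L(e)\in\mathcal{A}^*$ denotes the label of the edge $e$. Then $\hat\rho_{\mathcal{V}^2,\tilde G}(\mathcal{A})$ provides an estimate of $\rho(\mathcal{A})$ that satisfies $$\frac{1}{\sqrt[2l]{n}}\,\hat\rho_{\mathcal{V}^2,\tilde G}(\mathcal{A})\le\rho(\mathcal{A})\le\hat\rho_{\mathcal{V}^2,\tilde G}(\mathcal{A}).$$
   Context: The joint spectral radius is $\rho(\mathcal{A})=\lim_{k\to\infty}\max_{\sigma\in\{1,\ldots,m\}^k}\|A_{\sigma_k}\cdots A_{\sigma_1}\|^{1/k}$. Words and graphs. The matrices in $\mathcal{A}$ are regarded as letters of an alphabet. A word of length $k\ge1$ is a formal sequence $A_{i_k}\cdots A_{i_1}$ of letters, read from right to left and identified with the corresponding matrix product; $\mathcal{A}^*$ is the set of all finite words. The graph $\tilde G(\{1\},E)$ has one node and finitely many self-loops, each labeled by a word in $\mathcal{A}^*$. Expanded graph and path-completeness. The expanded graph of a graph is obtained by replacing every edge $i\to j$ whose label $A_{i_k}\cdots A_{i_1}$ has length $k>1$ by a path $i\to s_1\to\cdots\to s_{k-1}\to j$ through $k-1$ new nodes (new for each such edge), with consecutive edge labels $A_{i_1},\ldots,A_{i_k}$. A graph is path-complete if for every word $A_{\sigma_k}\cdots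 A_{\sigma_1}$ of any length $k\ge1$ there is a directed path (starting at any node) in the expanded graph with consecutive edge labels $A_{\sigma_1},\ldots,A_{\sigma_k}$. Bound. $\hat\rho_{\mathcal{V}^2,\tilde G}(\mathcal{A})$ is the infimum of $1/\gamma$ over all $\gamma>0$ for which there is a symmetric positive definite matrix $P$ with $\gamma^{2|L|}L^TPL\preceq P$ for every $L\in\tilde{\mathcal{A}}$, where $|L|$ is the length of the word $L$. *)

(* Defs.v *)
From HB Require Import structures.
From mathcomp Require Import all_boot all_order all_algebra.
From mathcomp Require Import all_classical all_reals all_analysis.
Import Order.TTheory GRing.Theory Num.Theory.
Import numFieldNormedType.Exports.

Set Implicit Arguments.
Unset Strict Implicit.
Unset Printing Implicit Defensive.

Local Open Scope classical_set_scope.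
Local Open Scope ring_scope.

(* A word over the letters A_0, ..., A_{m-1} is stored as its sequence of
   indices in reading order: A_{i_k} ... A_{i_1} is [:: i_1; ...; i_k].
   Words are formal: equal matrix products do not identify words. *)
Definition word (m : nat) := {s : seq 'I_m | (0 < size s)%N}.

Definition word_length (m : nat) (w : word m) : nat := size (val w).

(* The product A_{i_k} * ... * A_{i_1}; the leftmost factor is the last
   letter read, hence the reversal. *)
Definition word_mx (R : realType) (n m : nat) (A : 'I_m -> 'M[R]_n)
    (s : seq 'I_m) : 'M[R]_n :=
  \prod_(i <- rev s) A i.

Record is_norm (R : realType) (n : nat) (N : 'M[R]_n -> R) : Prop := IsNorm {
  norm_triangle : forall B C, N (B + C) <= N B + N C ;
  norm_scale : forall (a : R) B, N (a *: B) = `|a| * N B ;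
  norm_definite : forall B, N B = 0 -> B = 0 }.

(* The default value 0 of the maximum is harmless: the values are
   nonnegative, and there is at least one of them as soon as 0 < m. *)
Definition joint_spectral_radius (R : realType) (n m : nat)
    (N : 'M[R]_n -> R) (A : 'I_m -> 'M[R]_n) : R :=
  lim ((fun k : nat =>
    \big[Num.max/0]_(s : k.-tuple 'I_m) (N (word_mx A s) `^ (k%:R^-1)))
    @ \oo).

Record graph (T : Type) := Graph {
  node : finType ;
  edge : finType ;
  src : edge -> node ;
  tgt : edge -> node ;
  label : edge -> T }.

Definition labels (T : Type) (G : graph T) : set T := range (@label T G).

Section Expansion.
Variables (m : nat) (G : graph (word m)).

(* An edge whose label has length k brings k - 1 new nodes, and is replaced
   by k edges, one for each letter. *)
Definition xnode : finType :=
  (node G + {e : edge G & 'I_(word_length (label e)).-1})%type.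

Definition xedge : finType := {e : edge G & 'I_(word_length (label e))}.

(* Position t (0 <= t <= k) on the path that replaces e: the source of e for
   t = 0, the t-th new node (numbered from 0 in the ordinal) for 0 < t < k,
   and the target of e for t = k. *)
Definition xpos (e : edge G) (t : nat) : xnode :=
  if t == 0%N then inl (src e)
  else if (insub t.-1 : option 'I_(word_length (label e)).-1) is Some s
  then inr (Tagged (fun e => 'I_(word_length (label e)).-1) s)
  else inl (tgt e).

Definition expanded_graph : graph 'I_m := {|
  node := xnode ;
  edge := xedge ;
  src := fun x : xedge => xpos (tag x) (tagged x) ;
  tgt := fun x : xedge => xpos (tag x) (tagged x).+1 ;
  label := fun x : xedge => tnth (in_tuple (val (label (tag x)))) (tagged x) |}.

End Expansion.

Definition directed_path (T : Type) (G : graph T) (p : seq (edge G)) : bool :=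
  sorted (fun e f => tgt e == src f) p.

Definition path_complete (m : nat) (G : graph (word m)) : Prop :=
  forall w : word m, exists p : seq (edge (expanded_graph G)),
    directed_path p /\ [seq label e | e <- p] = val w.

Definition shortest_length (m : nat) (S : set (word m)) (l : nat) : Prop :=
  (exists2 w, S w & word_length w = l) /\
  (forall w, S w -> (l <= word_length w)%N).

Definition posdefmx (R : realType) (n : nat) (P : 'M[R]_n) : Prop :=
  P^T = P /\ forall x : 'cV[R]_n, x != 0 -> 0 < (x^T *m P *m x) 0 0.

Definition possemidefmx (R : realType) (n : nat) (P : 'M[R]_n) : Prop :=
  P^T = P /\ forall x : 'cV[R]_n, 0 <= (x^T *m P *m x) 0 0.

Definition loewner_le (R : realType) (n : nat) (B C : 'M[R]_n) : Prop :=
  possemidefmx (C - B).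

Definition quad_feasible (R : realType) (n m : nat) (A : 'I_m -> 'M[R]_n)
    (S : set (word m)) (gamma : R) : Prop :=
  exists P : 'M[R]_n, posdefmx P /\
    forall w, S w ->
      let L := word_mx A (val w) in
      loewner_le (gamma ^+ (2 * word_length w) *: (L^T *m P *m L)) P.

(* The set is bounded below by 0 and nonempty when S is finite (P = 1 with
   gamma small), so the real-valued inf is the genuine infimum. *)
Definition rho_hat (R : realType) (n m : nat) (A : 'I_m -> 'M[R]_n)
    (S : set (word m)) : R :=
  inf [set gamma^-1 | gamma in [set g : R | 0 < g /\ quad_feasible A S g]].

(* Main.v *)
Require Import Defs.
From HB Require Import structures.
From mathcomp Require Import all_boot all_order all_algebra.
From mathcomp Require Import all_classical all_reals all_analysis.
From mathcomp Require Import perm ring lra.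
Import Order.TTheory GRing.Theory Num.Theory.
Import numFieldNormedType.Exports.
Local Open Scope classical_set_scope.
Local Open Scope ring_scope.

(** Both inequalities compare the estimate with one number, [growth_rate A]:
    the infimum of the [r > 0] such that all products of [k] letters have size
    [O(r ^+ k)].  It is the joint spectral radius, whatever the norm that
    defines the latter ([joint_spectral_radius_growth_rate]): norms on matrices
    are equivalent, and a constant factor disappears under [k]-th roots.

    Upper bound.  If [gamma] is feasible with matrix [P], the norm
    [sqrt (x^T P x)] grows at most by the factor [gamma ^- k] under a label of
    length [k].  By path-completeness an arbitrary word is read along a path of
    the expanded graph: unless it lies inside one label, it is the end of a
    label, then a product of whole labels, then the beginning of a label.  The whole labels contribute exactly their
    power of [gamma^-1]; the two incomplete ones cost a constant, because there
    are finitely many labels.  Hence [gamma^-1] is a growth bound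
    ([path_complete_growth_bound]).

    Lower bound.  For [r] above the growth rate, the supremum over all words
    [s] of [|A_s x| / r ^+ size s] is a norm [nu] for which every word of
    length [k] has operator norm at most [r ^+ k] ([extremal_norm]).  By John's
    ellipsoid theorem, [nu] is within a factor [sqrt n] of a quadratic norm, so
    in that quadratic norm a label of length [k >= l] is bounded by
    [sqrt n * r ^+ k <= (n ^ (1 / 2l) * r) ^+ k]: the factor [sqrt n] is paid
    once per label, not once per letter.

    John's theorem is needed only up to an arbitrarily small loss in the factor
    ([john_ellipsoid]).  The maximal volume ellipsoid is then replaced by one
    whose volume is close enough to the supremum: if the unit ball reached
    further than [sqrt c] times the ellipsoid in some direction, with [c > n],
    then stretching the ellipsoid in that direction would multiply its volume by
    a factor above 1 that depends only on [n] and [c]. *)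

Set Implicit Arguments.
Unset Strict Implicit.
Unset Printing Implicit Defensive.

(** * Norms on matrices are equivalent *)

Record lmod_norm (R : realType) (V : lmodType R) (N : V -> R) : Prop := {
  lmod_normD : forall x y, N (x + y) <= N x + N y ;
  lmod_normZ : forall (a : R) x, N (a *: x) = `|a| * N x ;
  lmod_norm_eq0 : forall x, N x = 0 -> x = 0 }.

(** The sum of the moduli of the entries is a reference norm available in all
    formats at once, submultiplicative for rectangular products. *)
Definition l1norm (R : realType) (p q : nat) (M : 'M[R]_(p, q)) : R :=
  \sum_i \sum_j `|M i j|.

Section Norms.
Variables (R : realType) (V : lmodType R) (N : V -> R).
Hypothesis N_norm : lmod_norm N.

Lemma lmod_norm0 : N 0 = 0.
Proof. by rewrite -(scale0r 0) (lmod_normZ N_norm) normr0 mul0r. Qed.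

Lemma lmod_normN x : N (- x) = N x.
Proof. by rewrite -scaleN1r (lmod_normZ N_norm) normrN normr1 mul1r. Qed.

Lemma lmod_norm_ge0 x : 0 <= N x.
Proof.
have := lmod_normD N_norm x (- x).
by rewrite subrr lmod_norm0 lmod_normN; lra.
Qed.

Lemma lmod_norm_sum (I : Type) (r : seq I) (P : pred I) (F : I -> V) :
  N (\sum_(i <- r | P i) F i) <= \sum_(i <- r | P i) N (F i).
Proof.
apply: (big_ind2 (fun x y => N x <= y)); first by rewrite lmod_norm0.
  move=> x1 x2 y1 y2 h1 h2.
  by apply: le_trans (lmod_normD N_norm _ _) _; apply: lerD.
by [].
Qed.

Lemma lmod_norm_dist x y : `|N x - N y| <= N (x - y).
Proof.
have h1 := lmod_normD N_norm (x - y) y.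
have h2 := lmod_normD N_norm (y - x) x.
move: h1 h2; rewrite !subrK -(opprB x y) lmod_normN ler_norml => h1 h2.
by apply/andP; split; lra.
Qed.

End Norms.

Section MatrixNorms.
Variable R : realType.

Lemma le_entry_normr p q (x : 'M[R]_(p, q)) i j : `|x i j| <= `|x|.
Proof.
rewrite [leRHS]/Num.norm /= mx_normrE.
by apply: (le_bigmax _ (fun k : 'I_p * 'I_q => `|x k.1 k.2|) (i, j)).
Qed.

Lemma matrix_norm_le_normr p q (N : 'M[R]_(p, q) -> R) :
  lmod_norm N -> exists2 C, 0 < C & forall x, N x <= C * `|x|.
Proof.
move=> hN; pose C := \sum_i \sum_j N (delta_mx i j).
have C0 : 0 <= C by do 2!apply: sumr_ge0 => ? _; exact: lmod_norm_ge0.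
exists (C + 1) => [|x]; first lra.
apply: (@le_trans _ _ (C * `|x|)); last by rewrite ler_wpM2r //; lra.
rewrite {1}[x]matrix_sum_delta.
apply: le_trans (lmod_norm_sum hN _ _ _) _.
rewrite mulr_suml; apply: ler_sum => i _.
apply: le_trans (lmod_norm_sum hN _ _ _) _.
rewrite mulr_suml; apply: ler_sum => j _.
rewrite (lmod_normZ hN) mulrC ler_wpM2l ?lmod_norm_ge0 //.
exact: le_entry_normr.
Qed.

Lemma normr_mxvec p q (x : 'M[R]_(p, q)) : `|mxvec x| = `|x|.
Proof.
apply: le_anti; apply/andP; split.
  rewrite [leLHS]/Num.norm /= mx_normrE; apply/bigmax_leP; split=> // -[i k] _ /=.
  by case/mxvec_indexP: k => k l; rewrite ord1 mxvecE le_entry_normr.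
rewrite [leLHS]/Num.norm /= mx_normrE; apply/bigmax_leP; split=> // -[i k] _ /=.
by rewrite -mxvecE le_entry_normr.
Qed.

(** A norm is Lipschitz for the sup norm, hence attains its minimum on the
    compact unit sphere; definiteness makes this minimum positive. *)
Lemma row_norm_ge_normr n (N : 'rV[R]_n -> R) :
  lmod_norm N -> exists2 c, 0 < c & forall x, c * `|x| <= N x.
Proof.
move=> hN.
pose S := [set x : 'rV[R]_n | `|x| = 1].
(* An empty sphere means dimension 0, where every vector vanishes. *)
have [Sne|/set0P] := eqVneq S set0.
  exists 1 => // x; have [->|x0] := eqVneq x 0.
    by rewrite normr0 mulr0 lmod_norm_ge0.
  have : S (`|x|^-1 *: x).
    by rewrite /S /= normrZ normfV normr_id mulVf // normr_eq0.
  by rewrite Sne.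
move=> Sne; have [C C0 hC] := matrix_norm_le_normr hN.
have cN : continuous N.
  move=> x; apply: (proj2 (@cvgrPdist_lt _ _ _ (nbhs x) _ N (N x))) => e e0.
  have : \forall y \near nbhs x, `|x - y| < e / C.
    have := nbhsx_ballx x _ (divr_gt0 e0 C0).
    by rewrite -ball_normE.
  apply: filterS => y xy.
  apply: le_lt_trans (lmod_norm_dist hN _ _) _.
  apply: le_lt_trans (hC _) _.
  by rewrite mulrC -ltr_pdivlMr.
have [|c cS hc] := EVT_min_rV Sne _ (continuous_subspaceT cN).
  apply: bounded_closed_compact.
    by exists 1; split; [exact: num_real | move=> y y1 x /= ->; exact: ltW].
  rewrite (_ : S = (fun x : 'rV[R]_n => `|x|) @^-1` [set 1]) //.
  apply: closed_comp; last exact: closed_eq.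
  by move=> x _; exact: norm_continuous.
have c1 : `|c| = 1 by move: cS; rewrite inE.
exists (N c).
  rewrite lt_neqAle lmod_norm_ge0 // andbT eq_sym; apply/eqP => /(lmod_norm_eq0 hN) c0.
  by move: c1; rewrite c0 normr0 => /eqP; rewrite eq_sym oner_eq0.
move=> x; have [->|x0] := eqVneq x 0; first by rewrite normr0 mulr0 lmod_norm_ge0.
have x0' : 0 < `|x| by rewrite normr_gt0.
have : N c <= N (`|x|^-1 *: x).
  by apply: hc; rewrite inE /S /= normrZ normfV normr_id mulVf // normr_eq0.
by rewrite (lmod_normZ hN) normfV normr_id ler_pdivlMl // mulrC.
Qed.

Lemma matrix_norm_ge_normr p q (N : 'M[R]_(p, q) -> R) :
  lmod_norm N -> exists2 c, 0 < c & forall x, c * `|x| <= N x.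
Proof.
move=> hN.
have [|c c0 hc] := @row_norm_ge_normr _ (fun v => N (vec_mx v)).
  split=> [x y|a x|x].
  - by rewrite linearD; exact: lmod_normD.
  - by rewrite linearZ; exact: lmod_normZ.
  - by move/(lmod_norm_eq0 hN) => h; rewrite -[x]vec_mxK h linear0.
by exists c => // x; have := hc (mxvec x); rewrite mxvecK normr_mxvec.
Qed.

Lemma matrix_norm_equiv p q (N1 N2 : 'M[R]_(p, q) -> R) :
  lmod_norm N1 -> lmod_norm N2 ->
  exists2 C, 0 < C & forall x, N1 x <= C * N2 x.
Proof.
move=> /matrix_norm_le_normr[C C0 hC] /matrix_norm_ge_normr[c c0 hc].
exists (C / c) => [|x]; first exact: divr_gt0.
apply: le_trans (hC x) _.
by rewrite -mulrA ler_pM2l // ler_pdivlMl.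
Qed.

Lemma l1norm_lmod_norm p q : lmod_norm (@l1norm R p q).
Proof.
split=> [x y|a x|x].
- rewrite -big_split; apply: ler_sum => i _.
  rewrite -big_split; apply: ler_sum => j _.
  by rewrite mxE ler_normD.
- rewrite /l1norm mulr_sumr; apply: eq_bigr => i _.
  by rewrite mulr_sumr; apply: eq_bigr => j _; rewrite mxE normrM.
- move=> x0; apply/matrixP => i j; rewrite mxE; apply/eqP; rewrite -normr_le0.
  rewrite -x0 /l1norm (bigD1 i) //= (bigD1 j) //= -addrA lerDl addr_ge0 //.
    exact: sumr_ge0.
  by do 2!apply: sumr_ge0 => ? _.
Qed.

Lemma l1norm_mul p q r (B : 'M[R]_(p, q)) (C : 'M[R]_(q, r)) :
  l1norm (B *m C) <= l1norm B * l1norm C.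
Proof.
rewrite /l1norm mulr_suml; apply: ler_sum => i _.
apply: (@le_trans _ _ (\sum_k \sum_j `|B i j| * `|C j k|)).
  apply: ler_sum => k _; rewrite mxE.
  by apply: le_trans (ler_norm_sum _ _ _) _; apply: ler_sum => j _; rewrite normrM.
rewrite exchange_big mulr_suml; apply: ler_sum => j _ /=.
rewrite -mulr_sumr ler_wpM2l // (bigD1 j) //= lerDl.
by do 2!apply: sumr_ge0 => ? _.
Qed.

Lemma l1norm_ge0 p q (M : 'M[R]_(p, q)) : 0 <= l1norm M.
Proof. exact: lmod_norm_ge0 (@l1norm_lmod_norm p q) M. Qed.

Lemma l1norm_columns p q (M : 'M[R]_(p, q)) :
  l1norm M = \sum_j l1norm (M *m delta_mx j (0 : 'I_1)).
Proof.
rewrite {1}/l1norm exchange_big; apply: eq_bigr => j _ /=.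
by rewrite -colE; apply: eq_bigr => i _; rewrite big_ord1 mxE.
Qed.

End MatrixNorms.

(** * The growth rate of products *)

Section Growth.
Variables (R : realType) (n m : nat) (A : 'I_m -> 'M[R]_n).

Lemma word_mx_nil : word_mx A [::] = 1%:M.
Proof. by rewrite /word_mx big_nil. Qed.

Lemma word_mx_cat s t : word_mx A (s ++ t) = word_mx A t *m word_mx A s.
Proof. by rewrite /word_mx rev_cat big_cat. Qed.

Lemma word_mx1 i : word_mx A [:: i] = A i.
Proof. by rewrite /word_mx big_seq1. Qed.

Lemma word_mx_cons i s : word_mx A (i :: s) = word_mx A s *m A i.
Proof. by rewrite -cat1s word_mx_cat word_mx1. Qed.

Definition growth_bounds : set R := [set r | 0 < r /\
  exists C, forall s, l1norm (word_mx A s) <= C * r ^+ size s].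

Definition growth_rate : R := inf growth_bounds.

Lemma growth_bounds_const r : growth_bounds r ->
  exists2 C, 0 < C & forall s, l1norm (word_mx A s) <= C * r ^+ size s.
Proof.
move=> [r0 [C hC]]; exists (`|C| + 1) => [|s]; first by rewrite ltr_wpDl.
apply: le_trans (hC s) _; rewrite ler_pM2r ?exprn_gt0 //.
by apply: le_trans (ler_norm C) _; rewrite lerDl.
Qed.

Lemma growth_bounds_up r t : growth_bounds r -> r <= t -> growth_bounds t.
Proof.
move=> gr rt; have [r0 _] := gr; have [C C0 hC] := growth_bounds_const gr.
split; first exact: lt_le_trans rt.
exists C => s; apply: le_trans (hC s) _.
by rewrite ler_pM2l // lerXn2r // nnegrE ltW // (lt_le_trans r0).
Qed.

Lemma growth_bounds_letters r :
  0 < r -> (forall i, l1norm (A i) <= r) -> growth_bounds r.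
Proof.
move=> r0 hr; split=> //; exists (l1norm (1%:M : 'M[R]_n)) => s.
elim: s => [|i s IH]; first by rewrite word_mx_nil mulr1.
rewrite word_mx_cons; apply: le_trans (l1norm_mul _ _) _.
by rewrite exprSr mulrA ler_pM // l1norm_ge0.
Qed.

Lemma growth_bounds_nonempty : growth_bounds !=set0.
Proof.
exists (1 + \sum_i l1norm (A i)); apply: growth_bounds_letters.
  by rewrite ltr_wpDr // sumr_ge0 // => i _; exact: l1norm_ge0.
move=> i; rewrite (bigD1 i) //= addrCA lerDl addr_ge0 // sumr_ge0 // => j _.
exact: l1norm_ge0.
Qed.

Lemma growth_bounds_lbound : has_lbound growth_bounds.
Proof. by exists 0 => r [/ltW]. Qed.

Lemma growth_rate_ge0 : 0 <= growth_rate.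
Proof. by apply: (lb_le_inf growth_bounds_nonempty) => r [/ltW]. Qed.

Lemma growth_rate_lt r : growth_rate < r -> growth_bounds r.
Proof.
move=> gr; have := @inf_adherent _ growth_bounds (r - growth_rate).
rewrite subr_gt0 => /(_ gr)[].
  by split; [exact: growth_bounds_nonempty | exact: growth_bounds_lbound].
move=> t ht; rewrite -/growth_rate addrC subrK => /ltW.
exact: growth_bounds_up ht.
Qed.

(** Cutting a word into blocks of length [k] bounds it by a power of [r], up to
    a remainder shorter than [k], which costs a constant. *)
Lemma growth_bounds_of_length r k : 0 < r -> (0 < k)%N ->
  (forall s, size s = k -> l1norm (word_mx A s) <= r ^+ k) -> growth_bounds r.
Proof.
move=> r0 k0 hk; split=> //.
have [t gt] := growth_bounds_nonempty; have [t0 _] := gt.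
have [C C0 hC] := growth_bounds_const gt.
(* [t] is some growth bound with constant [C]; the power absorbs the quotients
   [(t / r) ^+ size s] of all remainders with [size s < k]. *)
exists (C * (1 + t / r) ^+ k) => s.
have tr0 : 0 < t / r by exact: divr_gt0.
have [j] := ubnP (size s); elim: j s => // j IH s /ltnSE sj.
have [sk|ks] := ltnP (size s) k.
  apply: le_trans (hC s) _; rewrite -mulrA ler_pM2l //.
  have -> : t ^+ size s = (t / r) ^+ size s * r ^+ size s.
    by rewrite -exprMn mulfVK // gt_eqF.
  rewrite ler_pM2r ?exprn_gt0 //.
  apply: (@le_trans _ _ ((1 + t / r) ^+ size s)).
    by rewrite lerXn2r ?nnegrE; lra.
  by apply: ler_weXn2l; [lra | exact: ltnW].
rewrite -{1}(cat_take_drop k s) word_mx_cat; apply: le_trans (l1norm_mul _ _) _.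
have -> : size s = (k + size (drop k s))%N by rewrite size_drop subnKC.
rewrite exprD mulrCA.
rewrite [leRHS]mulrC ler_pM ?l1norm_ge0 //.
  by apply: IH; rewrite size_drop (leq_trans _ sj) // ltn_subrL k0 (leq_trans k0).
by apply: hk; rewrite size_takel.
Qed.

Lemma growth_rate_witness r k : 0 < r -> r < growth_rate -> (0 < k)%N ->
  exists s : k.-tuple 'I_m, r ^+ k < l1norm (word_mx A s).
Proof.
move=> r0 rg k0; apply: contrapT => hs.
suff /(ge_inf growth_bounds_lbound) : growth_bounds r by rewrite leNgt rg.
apply: (growth_bounds_of_length r0 k0) => s sk.
rewrite leNgt; apply/negP => hlt; apply: hs.
by exists (Tuple (introT eqP sk)).
Qed.

End Growth.

Lemma cvg_root_const (R : realType) (K : R) :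
  0 < K -> K `^ (k%:R^-1) @[k --> \oo] --> (1 : R).
Proof.
move=> K0; rewrite -(cvg_shiftS (fun k => K `^ (k%:R^-1))).
rewrite (_ : (fun k => _) = fun k => expR (harmonic k * ln K)); last first.
  by apply/funext => k; rewrite /powR gt_eqF.
have h0 : harmonic k * ln K @[k --> \oo] --> 0 * ln K.
  by apply: cvgM; [exact: cvg_harmonic | exact: cvg_cst].
by have := cvg_comp _ _ h0 (@continuous_expR R _); rewrite mul0r expR0.
Qed.

(** For [r] above the growth rate, all the roots are eventually below [r] up to
    the [k]-th root of a constant.  For [r] below it, every length has a word
    whose norm exceeds [r ^+ k]: otherwise [r] would be a growth bound by
    [growth_bounds_of_length]. *)
Lemma joint_spectral_radius_growth_rate (R : realType) (n m : nat)
    (N : 'M[R]_n -> R) (A : 'I_m -> 'M[R]_n) :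
  lmod_norm N -> joint_spectral_radius N A = growth_rate A.
Proof.
move=> hN; have N_ge0 := lmod_norm_ge0 hN; apply/cvg_lim => //.
have [D D0 hD] := matrix_norm_equiv hN (@l1norm_lmod_norm R n n).
have [E E0 hE] := matrix_norm_equiv (@l1norm_lmod_norm R n n) hN.
apply/cvgrPdist_le => e e0.
have [C C0 hC] : exists2 C, 0 < C & forall s,
    l1norm (word_mx A s) <= C * (growth_rate A + e / 2) ^+ size s.
  by apply: growth_bounds_const; apply: growth_rate_lt; rewrite ltrDl divr_gt0.
set g := growth_rate A; have g0 : 0 <= g := growth_rate_ge0 A.
have up : \forall k \near \oo, (D * C) `^ (k%:R^-1) * (g + e / 2) < g + e.
  have h : (D * C) `^ (k%:R^-1) * (g + e / 2) @[k --> \oo] --> 1 * (g + e / 2).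
    by apply: cvgM; [exact: cvg_root_const (mulr_gt0 D0 C0) | exact: cvg_cst].
  by apply: (cvgr_lt _ h); lra.
have low : \forall k \near \oo, g - e < (E `^ (k%:R^-1))^-1 * (g - e / 2).
  have h : (E `^ (k%:R^-1))^-1 * (g - e / 2) @[k --> \oo] --> 1^-1 * (g - e / 2).
    apply: cvgM; last exact: cvg_cst.
    by apply: cvgV; [exact: oner_neq0 | exact: cvg_root_const].
  by apply: (cvgr_gt _ h); rewrite invr1 mul1r; lra.
near=> k.
have k0 : (0 < k)%N by near: k; exact: nbhs_infty_gt.
have kn0 : k%:R != 0 :> R by rewrite pnatr_eq0 -lt0n.
have kV0 : 0 <= k%:R^-1 :> R by rewrite invr_ge0.
have rootK (x : R) : 0 <= x -> (x ^+ k) `^ (k%:R^-1) = x.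
  by move=> x0; rewrite -powR_mulrn // -powRrM mulfV // powRr1.
rewrite ler_distlC; apply/andP; split; last first.
  apply/bigmax_leP; split; first by apply: ltW; lra.
  move=> s _; apply: (@le_trans _ _ ((D * C) `^ (k%:R^-1) * (g + e / 2))); last first.
    by apply: ltW; near: k.
  have ge0 : 0 <= g + e / 2 by lra.
  have DC0 : 0 <= D * C by apply: mulr_ge0; exact: ltW.
  have DCr0 : 0 <= D * C * (g + e / 2) ^+ k by rewrite mulr_ge0 ?exprn_ge0.
  rewrite -[X in _ * X](rootK _ ge0) -powRM ?exprn_ge0 //.
  apply: ge0_ler_powR; rewrite ?nnegrE ?N_ge0 //.
  apply: le_trans (hD _) _; rewrite -mulrA ler_pM2l //.
  by have := hC s; rewrite size_tuple.
have [ge|ge] := leP (g - e / 2) 0.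
  apply: (@le_trans _ _ 0); first lra.
  by apply: bigmax_ge_id.
have grate : g - e / 2 < growth_rate A by rewrite -/g; lra.
have [s hs] := growth_rate_witness ge grate k0.
apply: le_trans (le_bigmax _ _ s).
apply: (@le_trans _ _ ((E `^ (k%:R^-1))^-1 * (g - e / 2))).
  by apply: ltW; near: k.
rewrite mulrC ler_pdivrMr ?powR_gt0 // [leRHS]mulrC -{1}(rootK _ (ltW ge)).
have E0' : 0 <= E := ltW E0.
have ge' : 0 <= g - e / 2 := ltW ge.
rewrite -powRM ?N_ge0 //.
apply: ge0_ler_powR; rewrite ?nnegrE ?mulr_ge0 ?exprn_ge0 ?N_ge0 //.
exact: ltW (lt_le_trans hs (hE _)).
Unshelve. all: by end_near. Qed.

(** * Quadratic forms and determinants *)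

Section Quadratic.
Variables (R : realType) (n : nat).
Implicit Types (P : 'M[R]_n) (x y u : 'cV[R]_n).

Definition bform P x y : R := (x^T *m P *m y) 0 0.

Lemma bformDr P x y z : bform P x (y + z) = bform P x y + bform P x z.
Proof. by rewrite /bform mulmxDr mxE. Qed.

Lemma bformZr P a x y : bform P x (a *: y) = a * bform P x y.
Proof. by rewrite /bform -scalemxAr mxE. Qed.

Lemma bformDl P x y z : bform P (x + y) z = bform P x z + bform P y z.
Proof. by rewrite /bform linearD !mulmxDl mxE. Qed.

Lemma bformZl P a x y : bform P (a *: x) y = a * bform P x y.
Proof. by rewrite /bform linearZ -!scalemxAl mxE. Qed.

Lemma bform_sym P x y : P^T = P -> bform P x y = bform P y x.
Proof.
move=> PT; rewrite /bform -[RHS](mxE trmx_key (fun i j => (y^T *m P *m x) j i)).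
by rewrite -/(trmx _) !trmx_mul trmxK PT mulmxA.
Qed.

Lemma bform_sub_congr P (L : 'M[R]_n) c x :
  bform (P - c *: (L^T *m P *m L)) x x = bform P x x - c * bform P (L *m x) (L *m x).
Proof.
rewrite /bform mulmxBr mulmxBl -scalemxAr -scalemxAl trmx_mul !mulmxA.
by set U := _ *m x; set V := _ *m x; rewrite !mxE.
Qed.

Lemma bform_scalar a x : bform a%:M x x = a * \sum_i x i 0 ^+ 2.
Proof.
rewrite /bform mul_mx_scalar -scalemxAl mxE mxE; congr (_ * _).
by apply: eq_bigr => i _; rewrite mxE expr2.
Qed.

Lemma posdef_bform_ge0 P x : posdefmx P -> 0 <= bform P x x.
Proof.
move=> [_ hP]; have [->|x0] := eqVneq x 0; last exact: ltW (hP x x0).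
by rewrite /bform mulmx0 mxE.
Qed.

(** The triangle inequality is Cauchy-Schwarz, which is the nonnegativity of
    the form at [P(y,y) x - P(x,y) y]. *)
Lemma posdef_norm P : posdefmx P ->
  lmod_norm (fun x => Num.sqrt (bform P x x)).
Proof.
move=> hP; have [PT Ppos] := hP; have ge0 x := posdef_bform_ge0 x hP.
have cauchy x y : bform P x y <= Num.sqrt (bform P x x) * Num.sqrt (bform P y y).
  have [->|y0] := eqVneq y 0; first by rewrite /bform mulmx0 mxE mulr_ge0 ?sqrtr_ge0.
  have qy : 0 < bform P y y := Ppos y y0.
  rewrite -sqrtrM //; apply: le_trans (ler_norm _) _.
  rewrite -sqrtr_sqr ler_sqrt ?mulr_ge0 //.
  have := ge0 (bform P y y *: x + (- bform P x y) *: y).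
  rewrite !(bformDl, bformDr, bformZl, bformZr) (bform_sym y x PT).
  set q := bform P y y in qy *; set p := bform P x x; set b := bform P x y.
  rewrite (_ : _ + _ = q * (p * q - b ^+ 2)); last by ring.
  by rewrite pmulr_rge0 // subr_ge0.
split=> [x y|a x|x].
- have s0 z := sqrtr_ge0 (bform P z z).
  rewrite -(@ler_pXn2r _ 2) ?nnegrE ?addr_ge0 // sqrrD !sqr_sqrtr //.
  rewrite !(bformDl, bformDr) (bform_sym y x PT).
  by have := cauchy x y; lra.
- by rewrite bformZl bformZr mulrA -expr2 sqrtrM ?sqr_ge0 // sqrtr_sqr.
- move/eqP; rewrite sqrtr_eq0 => q0; apply/eqP; apply: contraT => x0.
  by have := Ppos x x0; rewrite ltNge -/(bform P x x) q0.
Qed.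

Lemma sqr_entry_le_sum x i : x i 0 ^+ 2 <= \sum_i x i 0 ^+ 2.
Proof.
rewrite (bigD1 i) //= lerDl sumr_ge0 // => j _; exact: sqr_ge0.
Qed.

Lemma sum_sqr_le_l1norm x : \sum_i x i 0 ^+ 2 <= l1norm x ^+ 2.
Proof.
rewrite expr2 {1}/l1norm mulr_suml; apply: ler_sum => i _; rewrite big_ord1.
rewrite -real_normK ?num_real // expr2 ler_wpM2l //.
rewrite /l1norm (bigD1 i) //= big_ord1 lerDl.
by do 2!apply: sumr_ge0 => ? _.
Qed.

Lemma l1norm_le_sum_sqr x : l1norm x ^+ 2 <= n%:R ^+ 2 * \sum_i x i 0 ^+ 2.
Proof.
set q := \sum_i _.
have q0 : 0 <= q by apply: sumr_ge0 => i _; exact: sqr_ge0.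
rewrite -[q]sqr_sqrtr // -exprMn lerXn2r ?nnegrE ?mulr_ge0 ?sqrtr_ge0 //.
  by do 2!apply: sumr_ge0 => ? _.
apply: (@le_trans _ _ (\sum_(i < n) Num.sqrt q)).
  apply: ler_sum => i _; rewrite big_ord1 -sqrtr_sqr ler_sqrt //.
  exact: sqr_entry_le_sum.
by rewrite sumr_const card_ord mulr_natl.
Qed.

(** Both sides are determinants of block triangular matrices conjugate by a
    block shear. *)
Lemma det_add_rank1 (u : 'cV[R]_n) (v : 'rV[R]_n) :
  \det (1%:M + u *m v) = 1 + (v *m u) 0 0.
Proof.
have E : block_mx 1%:M 0 v 1%:M *m block_mx (1%:M + u *m v) u 0 1%:M
   *m block_mx 1%:M 0 (- v) 1%:M = block_mx 1%:M u 0 (1%:M + v *m u).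
  rewrite !mulmx_block !(mul1mx, mul0mx, mulmx1, mulmx0, addr0, add0r).
  rewrite !mulmxN addrK mulmxDr mulmx1 mulmxDl mul1mx mulmxA.
  by rewrite [v + _]addrC subrr [v *m u + _]addrC.
have := congr1 determinant E.
rewrite !det_mulmx !det_lblock !det_ublock !det1 !(mul1r, mulr1) => ->.
by rewrite det_mx11 !mxE eqxx.
Qed.

(** A form that dominates [d] times the Euclidean one has an inverse with
    entries at most [d^-1], and the Leibniz formula bounds the determinant of
    that inverse.  A rough constant suffices: the purpose is that the volume of
    the ellipsoids inscribed in a given unit ball is bounded. *)
Lemma coercive_det_ge P d : 0 < d ->
  (forall x, d * \sum_i x i 0 ^+ 2 <= bform P x x) ->
  d ^+ n / n`!%:R <= `|\det P|.
Proof.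
move=> d0 hP.
have Pu : P \in unitmx.
  rewrite unitmxE unitfE; apply/negP => /det0P[v v0 vP].
  have := hP v^T; rewrite {1}/bform trmxK vP mul0mx mxE pmulr_rle0 // => h.
  case/negP: v0; apply/eqP/rowP => i; rewrite [in RHS]mxE; apply/eqP.
  rewrite -sqrf_eq0 eq_le sqr_ge0 andbT.
  by have := le_trans (sqr_entry_le_sum v^T i) h; rewrite mxE.
have entry i j : `|invmx P i j| <= d^-1.
  set y := col j (invmx P).
  have yy : bform P y y = y j 0.
    rewrite /bform -mulmxA [X in _ *m (P *m X)]colE mulKVmx // -colE.
    by rewrite 2!mxE.
  have := hP y; rewrite yy => hy.
  have sq k : d * (y k 0) ^+ 2 <= y j 0.
    by apply: le_trans hy; rewrite ler_pM2l //; exact: sqr_entry_le_sum.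
  have yj : y j 0 <= d^-1.
    have [yj0|yj0] := leP (y j 0) 0; first by apply: le_trans yj0 _; rewrite invr_ge0 ltW.
    rewrite -[leRHS]mul1r ler_pdivlMr // mulrC -(ler_pM2r yj0) mul1r -mulrA -expr2.
    exact: sq.
  have : (y i 0) ^+ 2 <= d^-1 ^+ 2.
    rewrite expr2 [leRHS]expr2 ler_pdivlMl // -expr2.
    exact: le_trans (sq i) yj.
  rewrite -(real_normK (num_real (y i 0))) ler_pXn2r ?nnegrE //.
    by rewrite mxE.
  by rewrite invr_ge0 ltW.
have detV : `|\det (invmx P)| <= n`!%:R * d^-1 ^+ n.
  apply: le_trans (ler_norm_sum _ _ _) _.
  apply: (@le_trans _ _ (\sum_(s : 'S_n) d^-1 ^+ n)).
    apply: ler_sum => s _; rewrite normrM normrX normrN1 expr1n mul1r.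
    rewrite normr_prod -[in leRHS](card_ord n) -prodr_const.
    by apply: ler_prod => i _; rewrite normr_ge0 entry.
  by rewrite sumr_const card_Sn mulr_natl.
have d1 : `|\det P| * `|\det (invmx P)| = 1.
  by rewrite -normrM -det_mulmx mulmxV // det1 normr1.
have nf : 0 < n`!%:R :> R by rewrite ltr0n fact_gt0.
have h : 1 <= `|\det P| * (n`!%:R * d^-1 ^+ n) by rewrite -[leLHS]d1 ler_wpM2l.
rewrite ler_pdivrMr // -[leLHS]mul1r.
apply: le_trans (ler_wpM2r (exprn_ge0 n (ltW d0)) h) _.
by rewrite exprVn -!mulrA mulVf ?mulr1 // expf_neq0 ?gt_eqF.
Qed.

End Quadratic.

(** * John's ellipsoid up to a small loss *)

Section John.
Variables (R : realType).

Lemma bernoulli_ineq (t : R) k : 0 <= t -> t <= 1 -> 1 - k%:R * t <= (1 - t) ^+ k.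
Proof.
move=> t0 t1; elim: k => [|k IH]; first by rewrite mul0r subr0.
rewrite exprS; apply: (@le_trans _ _ ((1 - t) * (1 - k%:R * t))).
  rewrite -natr1; have k0 : 0 <= k%:R :> R by [].
  by have := mulr_ge0 k0 (mulr_ge0 t0 t0); lra.
by rewrite ler_wpM2l //; lra.
Qed.

Lemma weighted_sqrD_le (p w t : R) : 0 < t -> t < 1 ->
  (p + w) ^+ 2 <= p ^+ 2 / t + w ^+ 2 / (1 - t).
Proof.
move=> t0 t1; have u0 : 0 < 1 - t by lra.
rewrite -subr_ge0.
rewrite (_ : _ - _ = ((1 - t) * p - t * w) ^+ 2 / (t * (1 - t))).
  by rewrite divr_ge0 ?sqr_ge0 ?mulr_ge0 // ltW.
by field; rewrite !gt_eqF.
Qed.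

(** The ellipsoid [x^T P x <= 1] lies in the unit ball of [nu].  Its volume is
    proportional to the inverse square root of the determinant of [P]. *)
Definition inscribed_ellipsoid n (nu : 'cV[R]_n -> R) : set 'M[R]_n :=
  [set P | P^T = P /\ forall x, nu x ^+ 2 <= bform P x x].

Section Improve.
Variables (n : nat) (nu : 'cV[R]_n -> R) (nu_norm : lmod_norm nu).
Variables (P : 'M[R]_n) (u : 'cV[R]_n) (k t : R).
Hypotheses (t0 : 0 < t) (t1 : t < 1) (k1 : 1 < k).

Let a := (1 - t)^-1.
Let b := (1 + (k - 1) * t)^-1.

(** When [P(u,u) = 1], this form is [b] times [P] on the line of [u] and [a]
    times [P] on its [P]-orthogonal complement: as [b < 1 < a], the ellipsoid
    becomes longer along [u] and thinner across. *)
Definition stretch : 'M[R]_n := a *: P + (b - a) *: (P *m u *m (P *m u)^T).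

Lemma bform_stretch x : P^T = P ->
  bform stretch x x = a * bform P x x + (b - a) * bform P u x ^+ 2.
Proof.
move=> PT; rewrite /stretch {1}/bform mulmxDr mulmxDl mxE.
rewrite -!scalemxAr -!scalemxAl mxE [(_ *: (_ *m _ *m _)) 0 0]mxE; congr (_ + _ * _).
rewrite mulmxA -(mulmxA _ _ x) mxE big_ord1 expr2; congr (_ * _).
  by rewrite bform_sym // /bform mulmxA.
by rewrite /bform trmx_mul PT.
Qed.

(** The unit ball of [nu] contains the ellipsoid of [P] and the points
    [sqrt k * u] and [- sqrt k * u], hence their convex hull, which contains
    the stretched ellipsoid.  In formulas: split [x] into a multiple of [u],
    measured by the norm of [u], and a rest, measured by [P]. *)
Lemma stretch_inscribed : inscribed_ellipsoid nu P -> bform P u u = 1 ->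
  k * nu u ^+ 2 <= 1 -> inscribed_ellipsoid nu stretch.
Proof.
move=> [PT hP] Puu hu; split.
  rewrite /stretch; set v := P *m u.
  by rewrite linearD !linearZ /= trmx_mul trmxK PT.
move=> x; rewrite bform_stretch //.
set s := bform P u x; set q := bform P x x.
have c0 : 0 < 1 + (k - 1) * t.
  by apply: addr_gt0 => //; apply: mulr_gt0 => //; rewrite subr_gt0.
have u0 : 0 < 1 - t by rewrite subr_gt0.
have k0 : 0 < k := lt_trans ltr01 k1.
(* This proportion of the [u]-component minimises the bound given below by
   [weighted_sqrD_le]. *)
pose c := k * t * b.
pose y := x - (c * s) *: u.
have nux : nu x <= `|c * s| * nu u + nu y.
  have -> : x = (c * s) *: u + y by rewrite /y addrC subrK.
  by apply: le_trans (lmod_normD nu_norm _ _) _; rewrite (lmod_normZ nu_norm).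
have nuy : nu y ^+ 2 <= q - 2 * c * s ^+ 2 + c ^+ 2 * s ^+ 2.
  apply: le_trans (hP y) _.
  rewrite /y -scaleNr bformDr !bformDl !bformZr !bformZl Puu.
  by rewrite (bform_sym x u PT) -/s -/q le_eqVlt; apply/orP; left; apply/eqP; ring.
have nuu : (`|c * s| * nu u) ^+ 2 <= c ^+ 2 * s ^+ 2 / k.
  rewrite exprMn real_normK ?num_real // exprMn.
  rewrite ler_wpM2l //; first by apply: mulr_ge0; exact: sqr_ge0.
  by rewrite -[k^-1]mul1r ler_pdivlMr // mulrC.
apply: (@le_trans _ _ ((`|c * s| * nu u + nu y) ^+ 2)).
  have nu0 := lmod_norm_ge0 nu_norm.
  by rewrite lerXn2r ?nnegrE ?addr_ge0 ?mulr_ge0.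
apply: le_trans (weighted_sqrD_le _ _ t0 t1) _.
apply: (@le_trans _ _ (c ^+ 2 * s ^+ 2 / k / t +
    (q - 2 * c * s ^+ 2 + c ^+ 2 * s ^+ 2) / (1 - t))).
  by rewrite lerD // ler_pM2r ?invr_gt0.
rewrite le_eqVlt; apply/orP; left; apply/eqP.
by rewrite /c /a /b; field; rewrite !gt_eqF.
Qed.

Lemma det_stretch : P^T = P -> bform P u u = 1 ->
  \det stretch = a ^+ n * (b / a) * \det P.
Proof.
move=> PT Puu.
have a0 : a != 0 by rewrite invr_eq0 gt_eqF // subr_gt0.
have -> : stretch = a *: (P *m (1%:M + u *m ((b / a - 1) *: (u^T *m P)))).
  rewrite /stretch mulmxDr mulmx1 scalerDr; congr (_ + _).
  rewrite -!scalemxAr scalerA; congr (_ *: _); first by field.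
  by rewrite trmx_mul PT !mulmxA.
rewrite detZ det_mulmx det_add_rank1 -scalemxAl mxE.
by rewrite -/(bform P u u) Puu mulr1 [1 + _]addrC subrK -mulrA [_ * \det P]mulrC.
Qed.

End Improve.

(** To first order in [t], the determinant is divided by [1 + (k - n) t]. *)
Lemma stretch_gain n (k : R) : (0 < n)%N -> n%:R < k ->
  exists t, [/\ 0 < t, t < 1 &
    (1 - t)^-1 ^+ n * ((1 + (k - 1) * t)^-1 / (1 - t)^-1) < 1].
Proof.
(* This [t] is small enough for the first-order term to dominate the
   second-order one in Bernoulli's lower bound of the inverse. *)
case: n => // n _ nk; exists ((k - n.+1%:R) / (2 * k * n.+1%:R)).
set t := _ / _.
have n0 : 0 <= n%:R :> R by [].
rewrite -natr1 in nk t *.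
have k0 : 0 < k by lra.
have d0 : 0 < 2 * k * (n%:R + 1) by rewrite !mulr_gt0 //; lra.
have t0 : 0 < t by rewrite divr_gt0 //; lra.
have tE : 2 * k * (n%:R + 1) * t = k - (n%:R + 1).
  by rewrite mulrC divfK // gt_eqF.
have t1 : t < 1.
  rewrite -(ltr_pM2l d0) mulr1 tE.
  by have := mulr_ge0 (ltW k0) n0; lra.
have u0 : 0 < 1 - t by lra.
have c0 : 0 < 1 + (k - 1) * t.
  by apply: addr_gt0 => //; apply: mulr_gt0 => //; lra.
split=> //.
rewrite [X in X < 1](_ : _ = ((1 - t) ^+ n * (1 + (k - 1) * t))^-1); last first.
  by rewrite exprVn exprS; field; rewrite expf_neq0 !gt_eqF.
rewrite invf_lt1 ?mulr_gt0 ?exprn_gt0 //.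
have := ler_wpM2r (ltW c0) (bernoulli_ineq n (ltW t0) (ltW t1)).
apply: lt_le_trans.
have h1 : 0 <= t * k := mulr_ge0 (ltW t0) (ltW k0).
have h2 : 0 <= t * n%:R := mulr_ge0 (ltW t0) n0.
have : 0 < t * (k - 1 - n%:R - n%:R * (k - 1) * t).
  apply: mulr_gt0 => //.
  by have := mulr_ge0 n0 (ltW t0); nra.
nra.
Qed.

(** Take an inscribed ellipsoid whose determinant exceeds the infimum by less
    than the gain of [stretch_gain].  In a direction where the upper bound
    failed, stretching would bring the determinant below the infimum. *)
Lemma john_ellipsoid n (nu : 'cV[R]_n -> R) (k : R) :
  (0 < n)%N -> lmod_norm nu -> n%:R < k ->
  exists2 P : 'M[R]_n, P^T = P &
    forall x, nu x ^+ 2 <= bform P x x <= k * nu x ^+ 2.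
Proof.
move=> n_gt0 hnu nk.
have nu0 := lmod_norm_ge0 hnu.
have [C C0 hC] := matrix_norm_equiv hnu (@l1norm_lmod_norm R n 1).
have [E E0 hE] := matrix_norm_equiv (@l1norm_lmod_norm R n 1) hnu.
have l10 (x : 'cV[R]_n) : 0 <= l1norm x := lmod_norm_ge0 (@l1norm_lmod_norm R n 1) x.
have [t [t0 t1 gain]] := stretch_gain n_gt0 nk.
have k1 : 1 < k by apply: le_lt_trans nk; rewrite ler1n.
set K := _ * _ in gain.
pose d := (E ^+ 2)^-1 ^+ n / n`!%:R.
have d0 : 0 < d by rewrite divr_gt0 ?exprn_gt0 ?invr_gt0 ?exprn_gt0 // ltr0n fact_gt0.
have dP P : inscribed_ellipsoid nu P -> d <= `|\det P|.
  move=> [_ hP]; apply: coercive_det_ge => [|x]; first by rewrite invr_gt0 exprn_gt0.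
  apply: le_trans (hP x); rewrite mulrC ler_pdivrMr ?exprn_gt0 // mulrC -exprMn.
  apply: le_trans (sum_sqr_le_l1norm x) _.
  by rewrite lerXn2r ?nnegrE ?mulr_ge0 // ltW.
pose S := [set `|\det P| | P in inscribed_ellipsoid nu].
have S0 : S !=set0.
  exists `|\det ((C ^+ 2 * n%:R ^+ 2)%:M : 'M[R]_n)|, (C ^+ 2 * n%:R ^+ 2)%:M => //.
  split=> [|x]; first by rewrite tr_scalar_mx.
  rewrite bform_scalar -mulrA.
  apply: (@le_trans _ _ ((C * l1norm x) ^+ 2)).
    by rewrite lerXn2r ?nnegrE ?mulr_ge0 // ltW.
  by rewrite exprMn ler_pM2l ?exprn_gt0 // l1norm_le_sum_sqr.
have Slb : has_lbound S by exists 0 => _ [P _ <-].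
have D0 : 0 < inf S.
  by apply: (lt_le_trans d0); apply: (lb_le_inf S0) => _ [P + <-]; exact: dP.
have K0 : 0 < K.
  rewrite /K; do 2?apply: mulr_gt0; rewrite ?invr_gt0 ?exprn_gt0 ?invr_gt0 ?subr_gt0 //.
  by apply: addr_gt0 => //; apply: mulr_gt0 => //; rewrite subr_gt0.
have eps0 : 0 < inf S / K - inf S by rewrite subr_gt0 ltr_pdivlMr // gtr_pMr.
have [_ [P hP <-]] := inf_adherent eps0 (conj S0 Slb).
rewrite addrC subrK ltr_pdivlMr // => hdet.
exists P => [|x]; first by case: hP.
rewrite (proj2 hP x) /= leNgt; apply/negP => hx.
have q0 : 0 < bform P x x.
  by apply: le_lt_trans hx; rewrite mulr_ge0 ?sqr_ge0 // (le_trans ler01) // ltW.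
pose r := Num.sqrt (bform P x x); have r0 : 0 < r by rewrite sqrtr_gt0.
have r2 : r ^+ 2 = bform P x x by rewrite sqr_sqrtr // ltW.
pose u := r^-1 *: x.
have Puu : bform P u u = 1.
  by rewrite bformZl bformZr -r2 expr2 mulKf ?gt_eqF // mulVf // gt_eqF.
have nuu : k * nu u ^+ 2 <= 1.
  rewrite (lmod_normZ hnu) exprMn real_normK ?num_real // mulrCA exprVn r2.
  by rewrite ler_pdivrMl // mulr1 ltW.
have : inf S <= `|\det (stretch P u k t)|.
  by apply: (ge_inf Slb); exists (stretch P u k t) => //; exact: stretch_inscribed.
rewrite det_stretch //; last by case: hP.
by rewrite normrM gtr0_norm // -/K mulrC leNgt hdet.
Qed.

End John.

(** * Extremal norms *)

Section Extremal.
Variables (R : realType) (n m : nat) (A : 'I_m -> 'M[R]_n).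

(** The norm is the supremum over all words [s] of [|A_s x| / r ^+ size s];
    multiplying [x] by a word only restricts the words over which the supremum
    is taken. *)
Lemma extremal_norm r : growth_bounds A r ->
  exists2 nu : 'cV[R]_n -> R, lmod_norm nu &
    forall s x, nu (word_mx A s *m x) <= r ^+ size s * nu x.
Proof.
move=> gr; have [r0 _] := gr; have [C C0 hC] := growth_bounds_const gr.
have l1N q := @l1norm_lmod_norm R n q.
pose E (x : 'cV[R]_n) := range (fun s => l1norm (word_mx A s *m x) / r ^+ size s).
have Ene x : E x !=set0 by exists (l1norm (word_mx A [::] *m x) / 1), [::].
have Eub x : ubound (E x) (C * l1norm x).
  move=> _ [s _ <-]; rewrite ler_pdivrMr ?exprn_gt0 // mulrAC.
  by apply: le_trans (l1norm_mul _ _) _; rewrite ler_wpM2r // l1norm_ge0.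
have Esup x : has_sup (E x) by split => //; exists (C * l1norm x).
have Ele x s : l1norm (word_mx A s *m x) <= r ^+ size s * sup (E x).
  rewrite mulrC -ler_pdivrMr ?exprn_gt0 //.
  by apply: ub_le_sup; [exists (C * l1norm x) | exists s].
have supE x b : (forall s, l1norm (word_mx A s *m x) <= r ^+ size s * b) ->
    sup (E x) <= b.
  move=> h; apply: ge_sup => // _ [s _ <-].
  by rewrite ler_pdivrMr ?exprn_gt0 // mulrC.
have l1le x : l1norm x <= sup (E x).
  by have := Ele x [::]; rewrite word_mx_nil mul1mx mul1r.
have supZ (a : R) x : sup (E (a *: x)) <= `|a| * sup (E x).
  apply: supE => s; rewrite -scalemxAr (lmod_normZ (l1N _)) mulrCA.
  by rewrite ler_wpM2l.
exists (fun x => sup (E x)); last first.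
  move=> s x; apply: supE => u; rewrite mulmxA -word_mx_cat.
  by apply: le_trans (Ele _ _) _; rewrite size_cat exprD mulrA [_ * r ^+ size u]mulrC.
split=> [x y|a x|x x0].
- apply: supE => s; rewrite mulmxDr mulrDr.
  by apply: le_trans (lmod_normD (l1N _) _ _) _; rewrite lerD.
- apply/eqP; rewrite eq_le supZ /=.
  have [->|a0] := eqVneq a 0.
    by rewrite normr0 mul0r (le_trans _ (l1le _)) // l1norm_ge0.
  rewrite -ler_pdivlMl ?normr_gt0 // -normfV -{1}[x](scalerK a0).
  exact: supZ.
- apply: (lmod_norm_eq0 (l1N 1)); apply: le_anti; rewrite l1norm_ge0 andbT.
  by rewrite -x0.
Qed.

Lemma growth_bounds_of_norm (nu : 'cV[R]_n -> R) r K :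
  lmod_norm nu -> 0 < r ->
  (forall s x, nu (word_mx A s *m x) <= K * r ^+ size s * nu x) ->
  growth_bounds A r.
Proof.
move=> hnu r0 h; split=> //.
have [E E0 hE] := matrix_norm_equiv (@l1norm_lmod_norm R n 1) hnu.
exists (\sum_j E * (K * nu (delta_mx j 0))) => s.
rewrite l1norm_columns mulr_suml; apply: ler_sum => j _.
apply: le_trans (hE _) _; rewrite -mulrA ler_pM2l // mulrAC.
exact: h.
Qed.

End Extremal.

(** * Words read along the expanded graph *)

Section PathComplete.
Variables (R : realType) (n m : nat) (A : 'I_m -> 'M[R]_n) (G : graph (word m)).
Variables (nu : 'cV[R]_n -> R) (r B : R).
Hypotheses (nu_norm : lmod_norm nu) (r_gt0 : 0 < r) (B_ge1 : 1 <= B).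
Hypothesis letter_bound : forall i x, nu (A i *m x) <= r * B * nu x.
Hypothesis label_bound : forall (e : edge G) x,
  nu (word_mx A (val (label e)) *m x) <= r ^+ word_length (label e) * nu x.

(** The state [y] when [t] letters of the label of [e] have been read, [c] being
    the initial bound multiplied by [r] for each letter read so far.  The first
    inequality gives the right bound once the label is completed; the second
    one controls words that stop in the middle of the label. *)
Definition within_label (e : edge G) (t : nat) (c : R) (y : 'cV[R]_n) : Prop :=
  nu (word_mx A (drop t (val (label e))) *m y) <=
    r ^+ (word_length (label e) - t) * c /\
  nu y <= B ^+ t * c.

Definition node_bound (v : xnode G) (c : R) (y : 'cV[R]_n) : Prop :=
  match v with
  | inl _ => nu y <= c
  | inr s => within_label (tag s) (tagged s).+1 c y
  end.

Lemma word_bound s x : nu (word_mx A s *m x) <= (r * B) ^+ size s * nu x.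
Proof.
have rB0 : 0 <= r * B by rewrite mulr_ge0 ?(ltW r_gt0) // (le_trans ler01).
elim: s x => [|i s IH] x; first by rewrite word_mx_nil mul1mx mul1r.
rewrite word_mx_cons -mulmxA; apply: le_trans (IH _) _.
by rewrite exprSr -mulrA ler_wpM2l ?exprn_ge0.
Qed.

Lemma node_bound_within e t c y : (t < word_length (label e))%N ->
  node_bound (xpos e t) c y -> within_label e t c y.
Proof.
rewrite /xpos; case: t => [|t] tk /=.
  move=> hy; split; last by rewrite mul1r.
  rewrite drop0 subn0; apply: le_trans (label_bound _ _) _.
  by rewrite ler_wpM2l // exprn_ge0 // ltW.
case: insubP => [s _ /= <- //|]; by rewrite -ltnS prednK ?tk // (leq_ltn_trans _ tk).
Qed.

Lemma within_node_bound e t c y : (t <= word_length (label e))%N ->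
  within_label e t c y -> node_bound (xpos e t) c y.
Proof.
rewrite /xpos; case: t => [|t] tk [h1 h2] /=; first by rewrite mul1r in h2.
case: insubP => [s _ /= st|]; first by rewrite [nat_of_ord s]st; split.
rewrite -leqNgt => kt /=.
have tE : t.+1 = word_length (label e).
  by apply/eqP; rewrite eqn_leq tk /=; move: kt; rewrite -subn1 leq_subLR.
by move: h1; rewrite tE subnn mul1r drop_size word_mx_nil mul1mx.
Qed.

Lemma within_label_step e (t : 'I_(word_length (label e))) c y :
  within_label e t c y ->
  within_label e t.+1 (r * c) (A (tnth (in_tuple (val (label e))) t) *m y).
Proof.
move=> [h1 h2]; split.
  rewrite mulmxA -word_mx_cons mulrA -exprSr subnSK //.
  by rewrite (tnth_nth (tnth (in_tuple (val (label e))) t)) -drop_nth.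
apply: le_trans (letter_bound _ _) _.
have rB0 : 0 <= r * B by rewrite mulr_ge0 ?(ltW r_gt0) // (le_trans ler01).
rewrite (_ : B ^+ t.+1 * (r * c) = r * B * (B ^+ t * c)); last by rewrite exprS; ring.
by rewrite ler_wpM2l.
Qed.

(** Reading one letter changes the bound by the factor [r] only: all the
    loss is in the powers of [B] carried by the inner nodes. *)
Lemma node_bound_step (x : edge (expanded_graph G)) c y :
  node_bound (src x) c y -> node_bound (tgt x) (r * c) (A (label x) *m y).
Proof.
case: x => e t /= h; apply: within_node_bound => //.
by apply: within_label_step; apply: node_bound_within.
Qed.

Lemma node_bound_path x (p : seq (edge (expanded_graph G))) c y :
  directed_path (x :: p) -> node_bound (src x) c y ->
  node_bound (tgt (last x p)) (r ^+ (size p).+1 * c)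
    (word_mx A [seq label e | e <- x :: p] *m y).
Proof.
elim: p x c y => [|x' p IH] x c y.
  by move=> _ /node_bound_step; rewrite /= word_mx1 expr1.
move=> /andP[/eqP xx' hp] /node_bound_step; rewrite xx' => /(IH _ _ _ hp).
by rewrite mulmxA -word_mx_cons mulrA -exprSr.
Qed.

Let K := B ^+ (\max_(e : edge G) word_length (label e)).

Lemma label_power_le (e : edge G) t : (t <= word_length (label e))%N -> B ^+ t <= K.
Proof.
move=> te; apply: ler_weXn2l => //; apply: leq_trans te _.
exact: leq_bigmax.
Qed.

(** A path may start inside a label: the remaining letters of that label are
    then estimated one by one, which costs the factor [K]. *)
Lemma node_bound_start v y : node_bound v (K * nu y) y.
Proof.
have nu0 := lmod_norm_ge0 nu_norm.
have K1 : 1 <= K by exact: exprn_ege1.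
case: v => [v|[e s]] /=; first by rewrite ler_peMl.
split=> /=; last first.
  rewrite mulrA ler_peMl // -[leLHS]mul1r ler_pM ?exprn_ege1 //.
apply: le_trans (word_bound _ _) _; rewrite size_drop exprMn -mulrA.
rewrite ler_wpM2l ?exprn_ge0 ?(ltW r_gt0) // ler_wpM2r //.
by apply: (label_power_le (e := e)); rewrite leq_subr.
Qed.

Lemma node_bound_end v c y : 0 <= c -> node_bound v c y -> nu y <= K * c.
Proof.
have K1 : 1 <= K by exact: exprn_ege1.
move=> c0; case: v => [v|[e s]] /=.
  by move=> h; apply: le_trans h _; rewrite ler_peMl.
move=> [_ h] /=; apply: le_trans h _; rewrite ler_wpM2r //.
by apply: (label_power_le (e := e)); case: s => s /= hs; rewrite (leq_trans hs) ?leq_pred.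
Qed.

Lemma path_complete_word_bound : path_complete G -> forall s x,
  nu (word_mx A s *m x) <= K ^+ 2 * r ^+ size s * nu x.
Proof.
move=> pc s x; have nu0 := lmod_norm_ge0 nu_norm.
have K1 : 1 <= K by exact: exprn_ege1.
have [s0|s0] := posnP (size s).
  by rewrite (size0nil s0) word_mx_nil mul1mx mulr1 ler_peMl // exprn_ege1.
have [[|e p] [hp /= ps]] := pc (exist _ s s0); first by rewrite -ps in s0.
have := node_bound_path hp (node_bound_start (src e) x).
have -> : (size p).+1 = size s by rewrite -ps /= size_map.
rewrite /= ps => /node_bound_end h.
apply: le_trans (h _) _.
  by rewrite mulr_ge0 ?exprn_ge0 ?(ltW r_gt0) // mulr_ge0 // (le_trans ler01).
by rewrite expr2 -!mulrA [r ^+ _ * _]mulrCA.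
Qed.

End PathComplete.

(** * Feasible factors and growth bounds *)

Section Bounds.
Variables (R : realType) (n m : nat) (A : 'I_m -> 'M[R]_n) (G : graph (word m)).

Lemma path_complete_growth_bound (nu : 'cV[R]_n -> R) (r : R) :
  lmod_norm nu -> 0 < r -> path_complete G ->
  (forall (e : edge G) x,
    nu (word_mx A (val (label e)) *m x) <= r ^+ word_length (label e) * nu x) ->
  growth_bounds A r.
Proof.
move=> hnu r0 pc hL.
have [C C0 hC] := matrix_norm_equiv hnu (@l1norm_lmod_norm R n 1).
have [E E0 hE] := matrix_norm_equiv (@l1norm_lmod_norm R n 1) hnu.
pose b := C * E * \sum_i l1norm (A i).
have b0 : 0 <= b.
  apply: mulr_ge0; first by rewrite mulr_ge0 // ltW.
  by apply: sumr_ge0 => i _; exact: l1norm_ge0.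
have B1 : 1 <= 1 + b / r by rewrite lerDl divr_ge0 // ltW.
apply: (growth_bounds_of_norm hnu r0 (path_complete_word_bound hnu r0 B1 _ hL pc)).
(* [b] bounds every letter for [nu]; the [1] makes the factor [1 + b / r] at
   least 1, as the powers of it that occur must be monotone. *)
have -> : r * (1 + b / r) = r + b by field; rewrite gt_eqF.
move=> i x.
have h : nu (A i *m x) <= b * nu x.
  apply: le_trans (hC _) _; rewrite /b -!mulrA ler_pM2l //.
  apply: le_trans (l1norm_mul _ _) _; rewrite mulrCA.
  apply: ler_pM; rewrite ?l1norm_ge0 //.
  rewrite (bigD1 i) //= lerDl; apply: sumr_ge0 => j _; exact: l1norm_ge0.
apply: le_trans h _; rewrite ler_wpM2r ?(lmod_norm_ge0 hnu) //.
by rewrite lerDr ltW.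
Qed.

Lemma feasible_growth_bound gamma : 0 < gamma -> path_complete G ->
  quad_feasible A (labels G) gamma -> growth_bounds A gamma^-1.
Proof.
move=> g0 pc [P [Ppos hL]].
apply: (path_complete_growth_bound (posdef_norm Ppos)) => // [|e x].
  by rewrite invr_gt0.
have [_ h] := hL (label e) (ex_intro2 _ _ e I erefl).
have := h x; rewrite -/(bform _ x x) bform_sub_congr subr_ge0 => hx.
set k := word_length _ in hx *.
have gk : 0 < gamma ^+ k by rewrite exprn_gt0.
rewrite exprVn ler_pdivlMl // -[leLHS]ger0_norm ?mulr_ge0 ?sqrtr_ge0 ?(ltW gk) //.
rewrite -sqrtr_sqr ler_sqrt ?posdef_bform_ge0 //.
by rewrite exprMn sqr_sqrtr ?posdef_bform_ge0 // -exprM mulnC.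
Qed.

(** With the form of John's theorem for the extremal norm of [r], a label of
    length [k] multiplies the form by at most [t ^+ (2 * l) * r ^+ (2 * k)], and
    [t ^+ (2 * l) <= t ^+ (2 * k)] since [l <= k]. *)
Lemma growth_bound_feasible r t l : (0 < n)%N -> growth_bounds A r ->
  0 < t -> (0 < l)%N -> n%:R < t ^+ (2 * l) ->
  (forall w, labels G w -> (l <= word_length w)%N) ->
  quad_feasible A (labels G) (r * t)^-1.
Proof.
move=> n0 gr t0 l0 nt hl; have [r0 _] := gr.
have [nu hnu hr] := extremal_norm gr.
have [P PT hP] := john_ellipsoid n0 hnu nt.
have nu0 := lmod_norm_ge0 hnu.
have t1 : 1 < t.
  rewrite -(@expr_gt1 _ (2 * l)) ?muln_gt0 ?l0 ?(ltW t0) //.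
  by apply: le_lt_trans nt; rewrite ler1n.
exists P; split.
  split=> // x x0; have /andP[h _] := hP x; apply: lt_le_trans h.
  rewrite exprn_gt0 // lt_neqAle nu0 andbT eq_sym.
  by apply: contra x0 => /eqP/(lmod_norm_eq0 hnu)/eqP.
move=> w hw /=; set L := word_mx _ _; set k := word_length w.
split.
  by rewrite linearB linearZ /= !trmx_mul trmxK PT mulmxA.
move=> x; rewrite -/(bform _ x x) bform_sub_congr subr_ge0.
have rt0 : 0 < r * t by rewrite mulr_gt0.
rewrite exprVn ler_pdivrMl ?exprn_gt0 // exprMn.
have /andP[_ hLx] := hP (L *m x); have /andP[hx _] := hP x.
apply: le_trans hLx _.
have hnuL : nu (L *m x) ^+ 2 <= r ^+ (2 * k) * nu x ^+ 2.
  rewrite mulnC exprM -exprMn lerXn2r ?nnegrE ?mulr_ge0 ?exprn_ge0 ?(ltW r0) //.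
  exact: hr.
have tk : t ^+ (2 * l) <= t ^+ (2 * k).
  by apply: ler_weXn2l; [exact: ltW | rewrite leq_mul2l hl].
rewrite [r ^+ _ * _]mulrC -mulrA.
apply: ler_pM => //; rewrite ?exprn_ge0 ?(ltW t0) //.
apply: le_trans hnuL _; rewrite ler_wpM2l // exprn_ge0 // ltW //.
Qed.

Lemma rho_hat_lbound (S : set (word m)) :
  has_lbound [set gamma^-1 | gamma in [set g : R | 0 < g /\ quad_feasible A S g]].
Proof. by exists 0 => _ [g [g0 _] <-]; rewrite invr_ge0 ltW. Qed.

End Bounds.

Unset Implicit Arguments.

Theorem theorem6p2 (R : realType) (n m : nat) (n_gt0 : (0 < n)%N)
    (N : 'M[R]_n -> R) (N_norm : is_norm N)
    (A : 'I_m -> 'M[R]_n)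
    (G : graph (word m)) (G_single_node : #|node G| = 1%N)
    (G_path_complete : path_complete G)
    (l : nat) (l_shortest : shortest_length (labels G) l) :
  (n%:R `^ ((2 * l)%:R^-1))^-1 * rho_hat A (labels G)
    <= joint_spectral_radius N A
  /\ joint_spectral_radius N A <= rho_hat A (labels G).
Proof.
have hN : lmod_norm N by case: N_norm => *; split.
rewrite (joint_spectral_radius_growth_rate _ hN).
have [[w0 _ w0l] hl] := l_shortest.
have l0 : (0 < l)%N by rewrite -w0l (valP w0).
have l2 : (2 * l)%:R != 0 :> R by rewrite pnatr_eq0 muln_eq0 -lt0n.
set T := n%:R `^ _; set g := growth_rate A.
have g0 : 0 <= g := growth_rate_ge0 A.
have T0 : 0 < T by rewrite powR_gt0 // ltr0n.
have Tl : T ^+ (2 * l) = n%:R.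
  by rewrite -powR_mulrn ?powR_ge0 // -powRrM mulVf // powRr1.
pose S := [set gamma^-1 | gamma in
  [set c : R | 0 < c /\ quad_feasible A (labels G) c]].
have feas r t : g < r -> T < t -> S (r * t).
  move=> gr Tt.
  have r0 : 0 < r := le_lt_trans g0 gr.
  have t0 : 0 < t := lt_trans T0 Tt.
  exists (r * t)^-1; last exact: invrK.
  split; first by rewrite invr_gt0 mulr_gt0.
  apply: (growth_bound_feasible n_gt0 (growth_rate_lt gr) t0 l0 _ hl).
  by rewrite -Tl ltr_pXn2r ?muln_gt0 ?l0 ?nnegrE ?ltW.
have Slb : has_lbound S := rho_hat_lbound A (labels G).
split; last first.
  apply: lb_le_inf.
    by exists ((g + 1) * (T + 1)); apply: feas; rewrite ltrDl.
  move=> _ [c [c0 hc] <-]; apply: (ge_inf (growth_bounds_lbound A)).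
  exact: feasible_growth_bound hc.
rewrite ler_pdivrMl //; apply/ler_addgt0Pr => e e0.
(* [(g + d) * (T + d) = g * T + d * (g + T + d)], where the last factor is at
   most [T + g + 1]. *)
pose d := Num.min 1 (e / (T + g + 1)).
have Tg0 : 0 < T + g + 1 by lra.
have d0 : 0 < d by rewrite lt_min ltr01 divr_gt0.
have d1 : d <= 1 by rewrite ge_min lexx.
have de : d * (T + g + 1) <= e by rewrite -ler_pdivlMr // ge_min lexx orbT.
apply: (@le_trans _ _ ((g + d) * (T + d))).
  by apply: (ge_inf Slb); apply: feas; rewrite ltrDl.
have := ler_wpM2l (ltW d0) d1.
lra.
Qed.
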